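(* Let $E/\mathbb{F}_q$ be an elliptic function field with full constant field $\mathbb{F}_q$ and $N$ rational places; let $r\ge2$, $\mathcal{G}$, $F=E^{\mathcal{G}}$, $Q_0,\dots,Q_s$, $P_{u,v}$, $z$, $\omega_0,\dots,\omega_{r-1}$, $M_u$, $M'_u$ and $V_E$ be as in the context, with $2\le s\le\lfloor\frac{N-2r-4}{r+1}\rfloor$ and $1\le t\le s$. Assume that for every $1\le u\le s$, every $(r-1)\times(r-1)$ submatrix of $M'_u$ is invertible. Define $$C_E=\Big\{\Big(f_{\mathbf a}(P_{1,1}),\dots,f_{\mathbf a}(P_{s,r+1}),\ \sum_{j=1}^ta_{0,j}z(Q_1)^{j-1},\dots,\sum_{j=1}^ta_{0,j}z(Q_s)^{j-1}\Big):f_{\mathbf a}\in V_E\Big\}.$$ Then $C_E$ is an $\mathbb{F}_q$-linear $(r,3)$-LRC of length $n=s(r+2)$ and dimension $k=rt-r+1$. Moreover, if $t=s$, then $C_E$ is optimal, i.e. its minimum distance equals $n-k-(\lceil k/r\rceil-1)\cdot2+1=n-(t-1)(r+2)$.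
   Context: $E/\mathbb{F}_q$ is an elliptic function field; $\mathcal{G}\subseteq\mathrm{Aut}(E/\mathbb{F}_q)$ is a subgroup of order $r+1$ with fixed field $F=E^{\mathcal{G}}$ a rational function field; $Q_0,Q_1,\dots,Q_s$ are distinct rational places of $F$ splitting completely in $E/F$, with $P_{u,1},\dots,P_{u,r+1}$ the places of $E$ over $Q_u$. $z\in F$ satisfies $F=\mathbb{F}_q(z)$ and $(z)_\infty=P_{0,1}+\cdots+P_{0,r+1}$ in $E$; $\omega_0=1$ and $\omega_1,\dots,\omega_{r-1}\in E$ satisfy $(\omega_i)_\infty=P_{0,1}+\cdots+P_{0,i+1}$, are linearly independent over $F$, and for each $1\le u\le s$ every $r\times r$ submatrix of $M_u=(\omega_i(P_{u,v}))_{1\le v\le r+1,\,0\le i\le r-1}$ is invertible. $M'_u=(\omega_i(P_{u,v}))_{1\le v\le r+1,\,1\le i\le r-1}$. $V_E=\{f_{\mathbf a}=\sum_{j=1}^{t}a_{0,j}z^{j-1}+\sum_{i=1}^{r-1}(\sum_{j=1}^{t-1}a_{i,j}z^{j-1})\omega_i: a_{i,j}\in\mathbb{F}_q\}$, with coefficient vectors $\mathbf a\in\mathbb{F}_q^{rt-r+1}$. For $r\ge1,\delta\ge2$, a linear code $C\subseteq\mathbb{F}_q^n$ is an $(r,\delta)$-LRC if for every coordinate $i$ there is a set $I_i\ni i$ with $|I_i|\le r+\delta-1$ such that the restriction of $C$ to the coordinates in $I_i$ has minimum distance at least $\delta$; an $[n,k,d]$ $(r,\delta)$-LRC satisfies $d\le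 n-k-(\lceil k/r\rceil-1)(\delta-1)+1$ and is optimal if equality holds. *)

(* Defs.v *)
(* Algebraic function fields E/K (K = F_q finite) are modelled
   via normalized discrete valuations, following Stichtenoth's definitions. *)
From HB Require Import structures.
From mathcomp Require Import all_boot all_order all_algebra.
Set Implicit Arguments. Unset Strict Implicit. Unset Printing Implicit Defensive.
Import Order.TTheory GRing.Theory Num.Theory.
Local Open Scope ring_scope.

Section FunctionFields.
Variables (K : finFieldType) (E : fieldType) (iota : {rmorphism K -> E}).

(* A place of the subfield S (S contains iota K) of E, given by its normalized
   discrete valuation v (values of v outside S \ {0} are irrelevant). *)
Definition is_valuation (S : E -> Prop) (v : E -> int) : Prop :=
  [/\ forall x y, S x -> S y -> x != 0 -> y != 0 -> v (x * y) = v x + v y,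
      forall x y, S x -> S y -> x != 0 -> y != 0 -> x + y != 0 ->
        Num.min (v x) (v y) <= v (x + y),
      forall c : K, c != 0 -> v (iota c) = 0 &
      exists t, [/\ S t, t != 0 & v t = 1]].

Definition allE : E -> Prop := fun _ => True.

Definition is_place (v : E -> int) : Prop := is_valuation allE v.

Definition same_place (S : E -> Prop) (v w : E -> int) : Prop :=
  forall x, S x -> x != 0 -> v x = w x.

Definition in_O (v : E -> int) (x : E) : Prop := x = 0 \/ 0 <= v x.
Definition in_Pm (v : E -> int) (x : E) : Prop := x = 0 \/ 0 < v x.

Definition res_indep (S : E -> Prop) (v : E -> int) d (b : 'I_d -> E) : Prop :=
  (forall i, S (b i) /\ in_O v (b i)) /\
  forall c : 'I_d -> K, in_Pm v (\sum_i iota (c i) * b i) -> forall i, c i = 0.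

(* degree of the place v of S/K = dimension over K of its residue field *)
Definition place_degree (S : E -> Prop) (v : E -> int) (d : nat) : Prop :=
  (exists b : 'I_d -> E, res_indep S v b) /\
  ~ (exists b : 'I_d.+1 -> E, res_indep S v b).

Definition rational_place_of (S : E -> Prop) (v : E -> int) : Prop :=
  is_valuation S v /\ place_degree S v 1.
Definition rational_place (v : E -> int) : Prop := rational_place_of allE v.

Definition K_indep m (b : 'I_m -> E) : Prop :=
  forall c : 'I_m -> K, \sum_i iota (c i) * b i = 0 -> forall i, c i = 0.

(* A divisor sum_i m_i Pl_i with pairwise distinct places Pl_i *)
Definition divisor_ok n (Pl : 'I_n -> E -> int) : Prop :=
  (forall i, is_place (Pl i)) /\
  (forall i j, i != j -> ~ same_place allE (Pl i) (Pl j)).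

Definition divisor_degree n (Pl : 'I_n -> E -> int) (m : 'I_n -> int) (d : int) :=
  exists dg : 'I_n -> nat,
    (forall i, place_degree allE (Pl i) (dg i)) /\ d = \sum_i m i * (dg i)%:Z.

Definition in_LRR n (Pl : 'I_n -> E -> int) (m : 'I_n -> int) (x : E) : Prop :=
  x = 0 \/
  ((forall i, - m i <= Pl i x) /\
   forall Q, is_place Q -> (forall i, ~ same_place allE Q (Pl i)) -> 0 <= Q x).

Definition ell n (Pl : 'I_n -> E -> int) (m : 'I_n -> int) (l : nat) : Prop :=
  (exists b : 'I_l -> E, (forall i, in_LRR Pl m (b i)) /\ K_indep b) /\
  ~ (exists b : 'I_l.+1 -> E, (forall i, in_LRR Pl m (b i)) /\ K_indep b).

Definition has_genus (g : nat) : Prop :=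
  (forall n (Pl : 'I_n -> E -> int) m d l,
      divisor_ok Pl -> divisor_degree Pl m d -> ell Pl m l -> d - l%:Z + 1 <= g%:Z) /\
  (exists n (Pl : 'I_n -> E -> int) m d l,
      [/\ divisor_ok Pl, divisor_degree Pl m d, ell Pl m l & d - l%:Z + 1 = g%:Z]).

Definition transcendental (x : E) : Prop :=
  forall p : {poly K}, (map_poly iota p).[x] = 0 -> p = 0.

Definition in_Kx (x y : E) : Prop :=
  exists p q : {poly K}, (map_poly iota q).[x] != 0 /\
    y = (map_poly iota p).[x] / (map_poly iota q).[x].

Definition function_field : Prop :=
  exists x, transcendental x /\
    exists m (b : 'I_m -> E), forall y, exists c : 'I_m -> E,
      (forall j, in_Kx x (c j)) /\ y = \sum_j c j * b j.

Definition full_constant_field : Prop :=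
  forall y, (exists p : {poly K}, p != 0 /\ (map_poly iota p).[y] = 0) ->
    exists c, y = iota c.

Definition elliptic_function_field : Prop :=
  [/\ function_field, full_constant_field & has_genus 1].

Definition num_rational_places (N : nat) : Prop :=
  exists Pl : 'I_N -> E -> int,
    [/\ forall i, rational_place (Pl i),
        forall i j, i != j -> ~ same_place allE (Pl i) (Pl j) &
        forall Q, rational_place Q -> exists i, same_place allE Q (Pl i)].

Definition is_autK (sigma : E -> E) : Prop :=
  [/\ forall x y, sigma (x + y) = sigma x + sigma y,
      forall x y, sigma (x * y) = sigma x * sigma y,
      sigma 1 = 1, bijective sigma &
      forall c, sigma (iota c) = iota c].

(* G_0, ..., G_{m-1} are the (pairwise distinct) elements of a subgroup of Aut(E/K)
   of order m (a finite nonempty set of automorphisms closed under composition). *)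
Definition aut_subgroup m (G : 'I_m -> E -> E) : Prop :=
  [/\ forall i, is_autK (G i),
      forall i j, i != j -> exists x, G i x != G j x &
      forall i j, exists k, forall x, G i (G j x) = G k x].

Definition fixed_field m (G : 'I_m -> E -> E) : E -> Prop :=
  fun x => forall i, G i x = x.

Definition lies_over (S : E -> Prop) (P Q : E -> int) : Prop :=
  exists e : nat, (0 < e)%N /\ forall x, S x -> x != 0 -> P x = e%:Z * Q x.

(* pole divisor of x equals sum_{i | A i} Pl_i (Pl pairwise distinct places) *)
Definition pole_divisor_is m (x : E) (Pl : 'I_m -> E -> int) (A : pred 'I_m) : Prop :=
  [/\ x != 0,
      forall i, A i -> Pl i x = -1 &
      forall Q, is_place Q -> (forall i, A i -> ~ same_place allE Q (Pl i)) -> 0 <= Q x].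

(* evaluation x(v) in K at a rational place v (x regular at v) *)
Definition evalp (v : E -> int) (x : E) : K :=
  odflt 0 [pick c : K | (x - iota c == 0) || (0 < v (x - iota c))].

End FunctionFields.
Arguments allE {E} _.

Section Codes.
Variable (K : finFieldType).

Definition hamming n (x y : 'rV[K]_n) : nat := #|[set j | x ord0 j != y ord0 j]|.

Definition linear_code n (C : {set 'rV[K]_n}) : Prop :=
  0 \in C /\ forall (a : K) x y, x \in C -> y \in C -> a *: x + y \in C.

Definition code_dim n (C : {set 'rV[K]_n}) : nat := \dim <<enum C>>%VS.

Definition restr_mindist_ge n (C : {set 'rV[K]_n}) (I : {set 'I_n}) (delta : nat) :=
  forall x y, x \in C -> y \in C -> [exists j in I, x ord0 j != y ord0 j] ->
    (delta <= #|[set j in I | x ord0 j != y ord0 j]|)%N.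

Definition is_LRC n (C : {set 'rV[K]_n}) (r delta : nat) : Prop :=
  forall i : 'I_n, exists I : {set 'I_n},
    [/\ i \in I, (#|I| <= r + delta - 1)%N & restr_mindist_ge C I delta].

Definition min_dist n (C : {set 'rV[K]_n}) (d : nat) : Prop :=
  (exists x y, [/\ x \in C, y \in C, x != y & hamming x y = d]) /\
  forall x y, x \in C -> y \in C -> x != y -> (d <= hamming x y)%N.

Definition ceil_div (k r : nat) : nat := (k + r.-1) %/ r.

(* optimal [n,k,d] (r,delta)-LRC: d attains the Singleton-like bound *)
Definition optimal_LRC n (C : {set 'rV[K]_n}) (r delta : nat) : Prop :=
  is_LRC C r delta /\
  min_dist C (n - code_dim C - (ceil_div (code_dim C) r - 1) * (delta - 1) + 1)%N.

End Codes.

Section Construction.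
Variables (K : finFieldType) (E : fieldType) (iota : {rmorphism K -> E}).
Variables (r s t : nat).
Variables (P : 'I_s.+1 -> 'I_r.+1 -> E -> int) (Q : 'I_s.+1 -> E -> int).
Variables (z : E) (omega : nat -> E).

Definition Mmat (u : 'I_s.+1) : 'M[K]_(r.+1, r) :=
  \matrix_(v < r.+1, i < r) evalp iota (P u v) (omega i).
Definition Mmat' (u : 'I_s.+1) : 'M[K]_(r.+1, r.-1) :=
  \matrix_(v < r.+1, i < r.-1) evalp iota (P u v) (omega i.+1).

(* f_a, with a_{0,j+1} = a0 j (j < t) and a_{i+1,j+1} = a1 (i,j) (i < r-1, j < t-1) *)
Definition f_a (a0 : {ffun 'I_t -> K}) (a1 : {ffun 'I_r.-1 * 'I_t.-1 -> K}) : E :=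
  \sum_(j < t) iota (a0 j) * z ^+ j +
  \sum_(i < r.-1) (\sum_(j < t.-1) iota (a1 (i, j)) * z ^+ j) * omega i.+1.

(* coordinate k (0-based) of the codeword:
   k = (u-1)(r+1) + (v-1) < s(r+1)  |->  f_a(P_{u,v});
   k = s(r+1) + (u-1)               |->  sum_j a_{0,j} z(Q_u)^(j-1) *)
Definition codeword_coord a0 a1 (k : nat) : K :=
  if (k < s * r.+1)%N then
    evalp iota (P (inord (k %/ r.+1).+1) (inord (k %% r.+1))) (f_a a0 a1)
  else
    \sum_(j < t) a0 j * evalp iota (Q (inord (k - s * r.+1).+1)) z ^+ j.

Definition code_CE : {set 'rV[K]_(s * (r + 2))} :=
  [set \row_(k < s * (r + 2)) codeword_coord ab.1 ab.2 k
    | ab : {ffun 'I_t -> K} * {ffun 'I_r.-1 * 'I_t.-1 -> K}].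

End Construction.

(* Main.v *)
Require Import Defs.
From HB Require Import structures.
From Stdlib Require Import Classical.
From mathcomp Require Import all_boot all_order all_algebra all_field.
From mathcomp Require Import zify ring.
Set Implicit Arguments. Unset Strict Implicit. Unset Printing Implicit Defensive.
Import Order.TTheory GRing.Theory Num.Theory.
Local Open Scope ring_scope.

(** On the block of [Q_u] the function [z] is the constant [z(Q_u)], so the [r + 2]
coordinates of the block are the entries of [M_u A] together with the first entry
of [A], where [A] lists the values at [z(Q_u)] of the coefficient polynomials.  The
minors of [M_u] and [M'_u] make this an MDS code of distance 3, which gives the
locality; since the [z(Q_u)] are distinct and the polynomials have degree less than
[t <= s], it also gives the dimension.

For [t = s], the word of [\prod_(u != u0) (z - z(Q_u))] has weight [r + 2].  For the
lower bound, [f_a] has at most as many zeros as poles, counted with multiplicity: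
at most [(t - 1)(r + 1)], and one less if all the additional coordinates vanish,
because then [a_{0,j} = 0] for all [j].

That a function has no more zeros than poles is deduced directly from the genus
being 1: if [f] has zeros [Z] and poles bounded by [B], then multiplication by
[f^M] embeds [L(M Z)] into [L(M B)], so that [M deg Z <= l(0) + M deg B] for all
[M]. *)

(** * Places, residues and evaluation *)

Section Valuations.
Variables (K : finFieldType) (E : fieldType) (iota : {rmorphism K -> E}).
Implicit Types (v : E -> int) (x y : E) (k l : int) (c d : K).

Definition val_ge v k x : Prop := x = 0 \/ k <= v x.

Lemma val_geW v k l x : l <= k -> val_ge v k x -> val_ge v l x.
Proof. by move=> lk [->|kx]; [left | right; apply: le_trans kx]. Qed.

Lemma val_ge_neq0 v k x : x != 0 -> val_ge v k x -> k <= v x.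
Proof. by move=> x0 [x0'|//]; rewrite x0' eqxx in x0. Qed.

Lemma in_PmE v x : in_Pm v x <-> val_ge v 1 x.
Proof. by split=> -[]; [left | right | left | right]; rewrite // ?gtz0_ge1 // -gtz0_ge1. Qed.

Section Place.
Variables (v : E -> int) (pv : is_place iota v).

Lemma placeM x y : x != 0 -> y != 0 -> v (x * y) = v x + v y.
Proof. by case: pv => vM _ _ _; apply: vM. Qed.

Lemma place_iota c : c != 0 -> v (iota c) = 0.
Proof. by case: pv => _ _ vc _; apply: vc. Qed.

Lemma place1 : v 1 = 0.
Proof. by rewrite -(rmorph1 iota) place_iota ?oner_eq0. Qed.

Lemma placeV x : x != 0 -> v x^-1 = - v x.
Proof.
move=> x0; apply/eqP; rewrite -subr_eq0 opprK addrC -placeM ?invr_eq0 //.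
by rewrite divff // place1.
Qed.

Lemma placeX x n : x != 0 -> v (x ^+ n) = v x *+ n.
Proof.
move=> x0; elim: n => [|n IH]; first by rewrite place1.
by rewrite exprS placeM ?expf_neq0 // IH mulrS.
Qed.

Lemma val_ge_iota c : val_ge v 0 (iota c).
Proof.
have [->|c0] := eqVneq c 0; first by rewrite rmorph0; left.
by right; rewrite place_iota.
Qed.

Lemma val_geD k x y : val_ge v k x -> val_ge v k y -> val_ge v k (x + y).
Proof.
move=> [->|kx]; first by rewrite add0r.
move=> [->|ky]; first by rewrite addr0; right.
have [->|x0] := eqVneq x 0; first by rewrite add0r; right.
have [->|y0] := eqVneq y 0; first by rewrite addr0; right.
have [->|xy0] := eqVneq (x + y) 0; first by left.
right; case: pv => _ vD _ _; apply: le_trans (vD x y I I x0 y0 xy0).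
by rewrite le_min kx.
Qed.

Lemma val_geM k l x y : val_ge v k x -> val_ge v l y -> val_ge v (k + l) (x * y).
Proof.
have [->|x0] := eqVneq x 0; first by left; rewrite mul0r.
have [->|y0] := eqVneq y 0; first by left; rewrite mulr0.
move=> /(val_ge_neq0 x0) kx /(val_ge_neq0 y0) ly.
by right; rewrite placeM // lerD.
Qed.

Lemma val_geZ k c x : val_ge v k x -> val_ge v k (iota c * x).
Proof. by move=> kx; rewrite -[k]add0r; apply: val_geM (val_ge_iota c) kx. Qed.

Lemma val_geX k x n : val_ge v k x -> val_ge v (k *+ n) (x ^+ n).
Proof.
move=> kx; elim: n => [|n IH]; first by right; rewrite place1.
by rewrite exprS mulrS; apply: val_geM.
Qed.

Lemma val_ge_sum k (I : Type) (s : seq I) (F : I -> E) :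
  (forall i, val_ge v k (F i)) -> val_ge v k (\sum_(i <- s) F i).
Proof.
by move=> kF; elim/big_ind: _ => //; [left | move=> x y; apply: val_geD].
Qed.

Lemma val_ge1_iota c : val_ge v 1 (iota c) -> c = 0.
Proof.
move=> vc; apply: contraTeq isT => c0.
by have := @val_ge_neq0 v 1 (iota c); rewrite fmorph_eq0 place_iota // => /(_ c0 vc).
Qed.

(** Relational form of [evalp]: it passes through sums, products and polynomials without regularity
    side conditions, and [residue_evalp] returns to [evalp]. *)
Definition residue_is x c : Prop := val_ge v 1 (x - iota c).

Lemma residue_is_ge0 x c : residue_is x c -> val_ge v 0 x.
Proof.
move=> xc; rewrite -[x](subrK (iota c)); apply: val_geD (val_ge_iota c).
exact: val_geW xc.
Qed.

Lemma residue_is_iota c : residue_is (iota c) c.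
Proof. by left; rewrite subrr. Qed.

Lemma residue_is_inj x c d : residue_is x c -> residue_is x d -> c = d.
Proof.
move=> xc xd; apply/eqP; rewrite eq_sym -subr_eq0; apply/eqP/val_ge1_iota.
have -> : iota (d - c) = (x - iota c) + iota (-1) * (x - iota d).
  by rewrite rmorphB rmorphN rmorph1; ring.
exact/val_geD/val_geZ.
Qed.

Lemma residue_isD x y c d :
  residue_is x c -> residue_is y d -> residue_is (x + y) (c + d).
Proof. by move=> xc yd; rewrite /residue_is rmorphD opprD addrACA; apply: val_geD. Qed.

Lemma residue_isM x y c d :
  residue_is x c -> residue_is y d -> residue_is (x * y) (c * d).
Proof.
move=> xc yd; rewrite /residue_is.
have -> : x * y - iota (c * d) = (x - iota c) * y + iota c * (y - iota d).
  by rewrite rmorphM; ring.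
apply: val_geD; last exact: val_geZ.
by rewrite -[1]addr0; apply: val_geM => //; apply: residue_is_ge0 yd.
Qed.

Lemma residue_isX x c n : residue_is x c -> residue_is (x ^+ n) (c ^+ n).
Proof.
move=> xc; elim: n => [|n IH]; last by rewrite !exprS; apply: residue_isM.
by rewrite !expr0 -(rmorph1 iota); apply: residue_is_iota.
Qed.

Lemma residue_is_sum (I : Type) (s : seq I) (F : I -> E) (f : I -> K) :
  (forall i, residue_is (F i) (f i)) ->
  residue_is (\sum_(i <- s) F i) (\sum_(i <- s) f i).
Proof.
move=> Ff; elim/big_rec2: _ => [|i x y _]; last exact: residue_isD.
by rewrite -(rmorph0 iota); apply: residue_is_iota.
Qed.

Lemma residue_is_horner (p : {poly K}) x c :
  residue_is x c -> residue_is (map_poly iota p).[x] p.[c].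
Proof.
move=> xc; elim/poly_ind: p => [|p a IH].
  by rewrite rmorph0 !horner0 -(rmorph0 iota); apply: residue_is_iota.
rewrite rmorphD rmorphM /= map_polyX map_polyC !hornerE.
by apply: residue_isD (residue_is_iota _); apply: residue_isM.
Qed.

Lemma residue_evalp x c : residue_is x c -> evalp iota v x = c.
Proof.
move=> xc; rewrite /evalp; case: pickP => [d /= xd|/(_ c)] /=.
  apply: residue_is_inj xc; apply/in_PmE.
  by case/orP: xd => [/eqP|]; [left | right].
by case: xc => [->|]; rewrite ?eqxx // gtz0_ge1 => ->; rewrite orbT.
Qed.

End Place.

(** Write [p] as [('X - c)^n q] with [q.[c] != 0]; then [q] at [x] has a nonzero residue, hence
    value 0. The exponent is fixed before [v], so it serves all such places. *)
Lemma val_horner (p : {poly K}) x c : x - iota c != 0 -> p != 0 ->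
  exists n, forall v, is_place iota v -> residue_is v x c ->
    (map_poly iota p).[x] != 0 /\ v (map_poly iota p).[x] = v (x - iota c) *+ n.
Proof.
move=> xc0 p0; have [n [q]] := multiplicity_XsubC p c.
rewrite p0 implyTb => qc ->; exists n => v pv xc.
rewrite rmorphM rmorphXn /= rmorphB /= map_polyX map_polyC !hornerE.
have := residue_is_horner pv q xc; set y := (map_poly iota q).[x] => yq.
have y0 : y != 0.
  apply: contraNneq qc => y0; rewrite y0 in yq; apply/eqP.
  by apply: (residue_is_inj pv yq); rewrite -(rmorph0 iota); apply: residue_is_iota.
split; first by rewrite mulf_neq0 ?expf_neq0.
rewrite (placeM pv) ?expf_neq0 // (placeX pv) // [v y](_ : _ = 0) ?add0r //.
apply/eqP; rewrite eq_le (val_ge_neq0 y0 (residue_is_ge0 pv yq)) andbT.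
rewrite leNgt gtz0_ge1; apply: contra qc => vy; apply/eqP/(residue_is_inj pv yq).
by rewrite /residue_is rmorph0 subr0; right.
Qed.

Lemma in_Kx_val x c y : x - iota c != 0 -> y != 0 -> in_Kx iota x y ->
  exists k, forall v, is_place iota v -> residue_is v x c -> v y = v (x - iota c) * k.
Proof.
move=> xc0 y0 [p [q [qx yE]]].
have q0 : q != 0 by apply: contraNneq qx => ->; rewrite rmorph0 horner0.
have p0 : p != 0.
  by apply: contraNneq y0 => p0; rewrite yE p0 rmorph0 horner0 mul0r.
have [a pa] := val_horner xc0 p0; have [b qb] := val_horner xc0 q0.
exists (a%:Z - b%:Z) => v pv xc; have [px va] := pa v pv xc; have [_ vb] := qb v pv xc.
rewrite yE (placeM pv) ?invr_eq0 // (placeV pv) // va vb.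
by rewrite -(mulr_natr _ a) -(mulr_natr _ b) !natz mulrBr.
Qed.

(** By [in_Kx_val] both places are determined on [S] by their value at [x - c], and normalization
    forces that value to be 1. *)
Lemma same_place_residue (S : E -> Prop) v w x c : x - iota c != 0 ->
  is_place iota v -> is_place iota w -> residue_is v x c -> residue_is w x c ->
  (forall y, S y -> in_Kx iota x y) ->
  (exists y, [/\ S y, y != 0 & v y = 1]) -> (exists y, [/\ S y, y != 0 & w y = 1]) ->
  same_place S v w.
Proof.
move=> xc0 pv pw vxc wxc SK.
have norm u : is_place iota u -> residue_is u x c ->
    (exists y, [/\ S y, y != 0 & u y = 1]) -> u (x - iota c) = 1.
  move=> pu uxc [y [Sy y0 uy]]; have [k kP] := in_Kx_val xc0 y0 (SK y Sy).
  have ge1 := val_ge_neq0 xc0 uxc.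
  have : (u (x - iota c) %| u y)%Z by rewrite (kP u pu uxc) dvdz_mulr.
  by rewrite uy dvdz1 => /eqP e1; rewrite -[LHS]gez0_abs ?e1 // (le_trans _ ge1).
move=> /(norm v pv vxc) v1 /(norm w pw wxc) w1 y Sy y0.
have [k kP] := in_Kx_val xc0 y0 (SK y Sy).
by rewrite (kP v) // (kP w) // v1 w1.
Qed.

Section RationalPlace.
Variables (v : E -> int) (rv : rational_place iota v).

Lemma rational_is_place : is_place iota v. Proof. by case: rv. Qed.
Let pv := rational_is_place.

(** The residue field has dimension 1, so 1 and [x] satisfy a relation [c0 + c1 x = 0] modulo the
    maximal ideal, with [c1 != 0]; the residue is [- c0 / c1]. *)
Lemma rational_residue x : val_ge v 0 x -> exists c, residue_is v x c.
Proof.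
move=> vx; case: rv => _ [_ dep2]; apply: NNPP => nox; apply: dep2.
exists (fun i : 'I_2 => if i == ord0 then 1 else x); split.
  by move=> i; split=> //; case: ifP => // _; right; rewrite place1.
move=> c; rewrite big_ord_recl big_ord1 /= mulr1 => /in_PmE.
set c0 := c ord0; set c1 := c _ => dep.
have [c10|c10] := eqVneq c1 0.
  rewrite c10 rmorph0 mul0r addr0 in dep => i.
  case: (unliftP ord0 i) => [j ->|->]; last exact: val_ge1_iota dep.
  by rewrite ord1 -c10.
case: nox; exists (- c0 / c1).
rewrite /residue_is [X in val_ge v 1 X](_ : _ = iota c1^-1 * (iota c0 + iota c1 * x)).
  exact: val_geZ.
rewrite rmorphM rmorphN !fmorphV; field; by rewrite fmorph_eq0.
Qed.

Lemma evalp_residue x : val_ge v 0 x -> residue_is v x (evalp iota v x).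
Proof. by move=> /rational_residue[c xc]; rewrite (residue_evalp pv xc). Qed.

End RationalPlace.
End Valuations.

(** * Zeros and poles in genus one *)

Section ZerosAndPoles.
Variables (K : finFieldType) (E : fieldType) (iota : {rmorphism K -> E}).
Implicit Types (v : E -> int) (x y : E) (L : E -> Prop).

(** Stated on independent families, so that [L] need not be shown to be a subspace, nor its
    dimension to exist. *)
Definition dim_le L k :=
  forall l (b : 'I_l -> E), (forall i, L (b i)) -> K_indep iota b -> (l <= k)%N.

Definition everywhere_regular x := forall v, is_place iota v -> val_ge v 0 x.

Lemma in_LRRP n (Pl : 'I_n -> E -> int) (m : 'I_n -> int) x :
  in_LRR iota Pl m x <->
  (forall i, val_ge (Pl i) (- m i) x) /\
  (forall v, is_place iota v -> (forall i, ~ same_place allE v (Pl i)) -> val_ge v 0 x).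
Proof.
split=> [[->|[mx rx]]|[mx rx]]; first by split=> *; left.
  by split=> *; right; auto.
have [->|x0] := eqVneq x 0; [by left | right; split=> [i|v pv nv]].
  exact: val_ge_neq0 (mx i).
by apply: val_ge_neq0 (rx v pv nv).
Qed.

Lemma K_indep_neq0 l (b : 'I_l -> E) i : K_indep iota b -> b i != 0.
Proof.
move=> ib; apply/eqP => bi0.
have := ib (fun j => (j == i)%:R); rewrite (bigD1 i) //= bi0 mulr0 add0r big1.
  by move=> /(_ erefl i)/eqP; rewrite eqxx oner_eq0.
by move=> j /negbTE->; rewrite rmorph0 mul0r.
Qed.

Lemma K_indep1 x : x != 0 -> K_indep iota (fun _ : 'I_1 => x).
Proof.
move=> x0 c; rewrite big_ord1 => /eqP; rewrite mulf_eq0 (negbTE x0) orbF fmorph_eq0.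
by move=> /eqP c0 i; rewrite (ord1 i).
Qed.

Lemma K_indep_widen l l' (le_ll' : (l <= l')%N) (b : 'I_l' -> E) :
  K_indep iota b -> K_indep iota (b \o widen_ord le_ll').
Proof.
move=> ib c sc.
pose c' (j : 'I_l') := if insub (val j) is Some j' then c j' else 0.
have c'w j : c' (widen_ord le_ll' j) = c j by rewrite /c' valK.
move=> i; rewrite -c'w; apply: ib; rewrite -[RHS]sc.
rewrite (bigID (fun j : 'I_l' => (j < l)%N)) /= [X in _ + X]big1 ?addr0.
  by rewrite (big_ord_narrow le_ll'); apply: eq_bigr => j _; rewrite c'w.
by move=> j jl; rewrite /c' insubN // rmorph0 mul0r.
Qed.

Lemma dim_le0 L x : dim_le L 0 -> L x -> x = 0.
Proof.
move=> L0 Lx; apply/eqP; apply: contraT => x0.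
by have := L0 1%N (fun _ => x) (fun _ => Lx) (K_indep1 x0).
Qed.

Lemma dim_le_mul L L' y k : y != 0 ->
  (forall x, L x -> L' (x * y)) -> dim_le L' k -> dim_le L k.
Proof.
move=> y0 LL' bL' l b Lb ib; apply: (bL' l (fun i => b i * y)) => [i|c].
  exact: LL'.
move=> sc; apply: ib; apply: (mulIf y0); rewrite mul0r -[RHS]sc mulr_suml.
by apply: eq_bigr => i _; rewrite mulrA.
Qed.

Lemma ell_dim_le n (Pl : 'I_n -> E -> int) m l :
  ell iota Pl m l -> dim_le (in_LRR iota Pl m) l.
Proof.
move=> [_ noS] l' b Lb ib; rewrite leqNgt; apply/negP => ll'; apply: noS.
by exists (b \o widen_ord ll'); split; [move=> i; apply: Lb | apply: K_indep_widen].
Qed.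

(** The genus speaks of exact dimensions; descending from [k] to the largest size of an independent
    family produces one. *)
Lemma dim_le_ell n (Pl : 'I_n -> E -> int) m k :
  dim_le (in_LRR iota Pl m) k -> exists2 l, (l <= k)%N & ell iota Pl m l.
Proof.
elim: k => [|k IH] bL.
  exists 0%N => //; split; last by move=> [b [Lb /(bL _ _ Lb)]].
  by exists (fun _ => 0); split=> [|c _] [].
have [[b [Lb ib]]|nob] := classic (exists b : 'I_k.+1 -> E,
    (forall i, in_LRR iota Pl m (b i)) /\ K_indep iota b).
  exists k.+1 => //; split; first by exists b.
  by move=> [b' [Lb' /(bL _ _ Lb')]]; rewrite ltnn.
have [l' b Lb ib|l lk ?] := IH; last by exists l => //; apply: leqW.
have := bL _ _ Lb ib; rewrite leq_eqVlt => /orP[/eqP l'k|]; last by rewrite ltnS.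
by case: nob; subst l'; exists b.
Qed.

(** If some member [x] of the family lies outside [L(m)], it has the extremal pole order at [Pl i0].
    Subtracting suitable multiples of [x] moves all other members into [L(m)]. *)
Lemma dim_le_add_rational n (Pl : 'I_n -> E -> int) (m m' : 'I_n -> int) i0 k :
  (forall i, is_place iota (Pl i)) -> rational_place iota (Pl i0) ->
  (forall i, m' i <= m i + (i == i0)%:Z) ->
  dim_le (in_LRR iota Pl m) k -> dim_le (in_LRR iota Pl m') k.+1.
Proof.
move=> pPl rP mm' bL [//|l] b Lb ib.
have [Lmb|] := classic (forall i, in_LRR iota Pl m (b i)).
  exact: leqW (bL _ _ Lmb ib).
move=> /not_all_ex_not[i1 nL]; rewrite ltnS.
have /in_LRRP[gb rb] := Lb i1.
have x0 := K_indep_neq0 i1 ib; set x := b i1 in x0 gb rb nL.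
have P0 := pPl i0.
have vx : Pl i0 x = - m i0 - 1.
  have := val_ge_neq0 x0 (gb i0); have := mm' i0; rewrite eqxx => mm0 gx.
  suff : ~~ (- m i0 <= Pl i0 x) by lia.
  apply/negP => gx'; apply/nL/in_LRRP; split=> // i.
  have [->|ii0] := eqVneq i i0; first by right.
  apply: val_geW (gb i); have := mm' i; rewrite (negbTE ii0); lia.
have ge_div j : val_ge (Pl i0) 0 (b j / x).
  have /in_LRRP[gj _] := Lb j; have -> : 0 = (- m i0 - 1) - Pl i0 x by rewrite vx subrr.
  apply: (val_geM P0); last by right; rewrite (placeV P0).
  by apply: val_geW (gj i0); have := mm' i0; rewrite eqxx; lia.
pose c j := evalp iota (Pl i0) (b j / x).
have cP j : residue_is iota (Pl i0) (b j / x) (c j) by apply: evalp_residue.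
apply: (bL l (fun j => b (lift i1 j) - iota (c (lift i1 j)) * x)) => [j|d].
  have /in_LRRP[gj rj] := Lb (lift i1 j); set bj := b _ in gj rj *.
  have ge_diff v e : is_place iota v -> val_ge v e bj -> val_ge v e x ->
      val_ge v e (bj - iota (c (lift i1 j)) * x).
    move=> pv vb vx'; rewrite -mulNr -rmorphN.
    by apply: (val_geD pv) => //; apply: (val_geZ pv).
  apply/in_LRRP; split=> [i|v pv nv]; last by apply: ge_diff; auto.
  have [->|ii0] := eqVneq i i0; last first.
    have := mm' i; rewrite (negbTE ii0) addr0 => mm.
    apply: (@val_geW _ _ (- m' i)); first by rewrite lerN2.
    by apply: ge_diff.
  have -> : bj - iota (c (lift i1 j)) * x = (bj / x - iota (c (lift i1 j))) * x.
    by rewrite mulrBl divfK.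
  have -> : - m i0 = 1 + (- m i0 - 1) by lia.
  by apply: (val_geM P0); [apply: cP | right; rewrite vx].
move=> sd j.
(* A relation among the corrected members becomes one among the [b i]; the coefficient of [x]
   collects the subtracted multiples. *)
pose e i := if unlift i1 i is Some j' then d j' else - \sum_j d j * c (lift i1 j).
have el j' : e (lift i1 j') = d j' by rewrite /e liftK.
rewrite -el; apply: ib; rewrite (bigD1_ord i1) //= -[RHS]sd /e unlift_none.
rewrite rmorphN rmorph_sum mulNr mulr_suml -sumrN -big_split /=.
by apply: eq_bigr => j' _; rewrite liftK rmorphM -/x; ring.
Qed.

(** Induction on the degree of [B], removing one rational place at a time; for [B = 0] only
    everywhere regular functions remain. *)
Lemma dim_le_effective n (Pl : 'I_n -> E -> int) (B : 'I_n -> nat) k :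
  (forall i, rational_place iota (Pl i)) -> dim_le everywhere_regular k ->
  dim_le (in_LRR iota Pl (fun i => (B i)%:Z)) (k + \sum_i B i).
Proof.
move=> rP bk; have pP i := rational_is_place (rP i).
have [N NB] := ubnP (\sum_i B i)%N; elim: N B NB => // N IH B NB.
have [B0|] := boolP [forall i, B i == 0%N].
  move=> l b Lb ib; apply: leq_trans (leq_addr _ _); apply: bk ib => i v pv.
  have /in_LRRP[gb rb] := Lb i.
  have [/not_all_ex_not[j /NNPP vj]|nv] := classic (~ forall j, ~ same_place allE v (Pl j)).
    have [->|b0] := eqVneq (b i) 0; first by left.
    right; rewrite (vj _ I b0); have := val_ge_neq0 b0 (gb j).
    by rewrite (eqP (forallP B0 j)) oppr0.
  by apply: rb => //; apply: NNPP.
rewrite negb_forall => /existsP[i0 Bi0].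
pose B' i := (B i - (i == i0))%N.
have sumB : (\sum_i B i = (\sum_i B' i).+1)%N.
  rewrite (bigD1 i0) //= [in RHS](bigD1 i0) //= {1}/B' eqxx.
  rewrite (eq_bigr B') => [|i /negbTE ii0]; first lia.
  by rewrite /B' ii0 subn0.
rewrite sumB addnS.
apply: (@dim_le_add_rational _ Pl (fun i => (B' i)%:Z) _ i0) => // [i|].
  by rewrite /B'; case: eqP => _; lia.
by apply: IH; lia.
Qed.

(** * Riemann's inequality in genus one and the zero count *)

Hypothesis genus1 : has_genus iota 1.

Lemma genus1_degree_le n (Pl : 'I_n -> E -> int) m d k :
  divisor_ok iota Pl -> divisor_degree iota Pl m d ->
  dim_le (in_LRR iota Pl m) k -> d <= k%:Z.
Proof.
move=> okP dP /dim_le_ell[l lk /(proj1 genus1 _ _ _ _ _ okP dP)]; lia.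
Qed.

Lemma place_degree_gt0 v d : is_place iota v -> place_degree iota allE v d -> (0 < d)%N.
Proof.
case: d => // pv [_ []]; exists (fun _ => 1); split.
  by move=> i; split=> //; right; rewrite (place1 pv).
move=> c; rewrite big_ord1 mulr1 => /in_PmE/(val_ge1_iota pv) c0 i.
by rewrite (ord1 i).
Qed.

Lemma place_surj v k : is_place iota v -> exists2 x, x != 0 & v x = k.
Proof.
move=> pv; have [_ _ _ [t [_ t0 vt]]] := pv.
case: k => k; [exists (t ^+ k) | exists (t^-1 ^+ k.+1)].
all: rewrite ?expf_neq0 ?invr_eq0 // (placeX pv) ?invr_eq0 // ?(placeV pv) // vt.
  by rewrite natz.
by rewrite NegzE mulNrn natz.
Qed.

(** Here the place may have any degree. Scaling by [y] of value [m i0 + 1] maps the larger space to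
    the residue field of [Pl i0]; the kernel lies in [L(m) = 0], so the map is injective. *)
Lemma dim_le_add_place n (Pl : 'I_n -> E -> int) (m : 'I_n -> int) i0 d :
  (forall i, is_place iota (Pl i)) -> place_degree iota allE (Pl i0) d ->
  dim_le (in_LRR iota Pl m) 0 ->
  dim_le (in_LRR iota Pl (fun i => m i + (i == i0)%:Z)) d.
Proof.
move=> pP [_ nores] L0 l b Lb ib; have P0 := pP i0; rewrite leqNgt; apply/negP => dl; apply: nores.
have [y y0 vy] := place_surj (m i0 + 1) P0.
pose b' := b \o widen_ord dl; exists (fun i => y * b' i).
have Lb' i : in_LRR iota Pl (fun i => m i + (i == i0)%:Z) (b' i) by apply: Lb.
split=> [i|c].
  have /in_LRRP[gb _] := Lb' i; split=> //; have := gb i0; rewrite eqxx => gi.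
  change (val_ge (Pl i0) 0 (y * b' i)); rewrite -[0](subrr (m i0 + 1)).
  by apply: (val_geM P0) => //; right; rewrite vy.
move=> /in_PmE sc.
have sumE : \sum_i iota (c i) * (y * b' i) = y * \sum_i iota (c i) * b' i.
  by rewrite mulr_sumr; apply: eq_bigr => i _; ring.
have ib' : K_indep iota b' by apply: K_indep_widen.
apply: ib'; apply: (dim_le0 L0); apply/in_LRRP; split=> [i|v pv nv].
  have [->|ii0] := eqVneq i i0.
    rewrite [X in val_ge _ _ X](_ : _ = y^-1 * \sum_i iota (c i) * (y * b' i)).
      have -> : - m i0 = - (m i0 + 1) + 1 by ring.
      by apply: (val_geM P0) => //; right; rewrite (placeV P0) // vy.
    by rewrite sumE mulKf.
  apply: (val_ge_sum (pP i)) => j; apply: (val_geZ (pP i)).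
  by have /in_LRRP[/(_ i)] := Lb' j; rewrite (negbTE ii0) addr0.
apply: (val_ge_sum pv) => j; apply: (val_geZ pv).
by have /in_LRRP[_] := Lb' j; apply.
Qed.

(* The definition of the genus provides a divisor [A] with [l(A) = deg A].  If
   [L(A)] is zero, [A] is enlarged by one of its places. A nonzero element of
   the resulting finite-dimensional space embeds [L(0)] into it. *)
Lemma finite_dim_regular : exists k, dim_le everywhere_regular k.
Proof.
have dim_le_embed n (Pl : 'I_n -> E -> int) m l : divisor_ok iota Pl ->
    ell iota Pl m l -> (0 < l)%N -> exists k, dim_le everywhere_regular k.
  move=> [pP _] eP; case: l eP => // l eP _; have [[b [Lb ib]] _] := eP.
  exists l.+1; apply: dim_le_mul (K_indep_neq0 ord0 ib) _ (ell_dim_le eP).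
  move=> x rx; have /in_LRRP[gb rb] := Lb ord0.
  apply/in_LRRP; split=> [i|v pv nv].
    by rewrite -[- m i]add0r; apply: (val_geM (pP i)) => //; apply: rx.
  by rewrite -[0]addr0; apply: (val_geM pv); [apply: rx | apply: rb].
have [_ [n [Pl [m [d [l [okP dP eP]]]]]]] := genus1.
have [l0|l0] := ltnP 0 l; first by move=> _; apply: dim_le_embed okP eP l0.
move: l0 eP; rewrite leqn0 => /eqP-> eP dl; have L0 := ell_dim_le eP.
have [dg [dgP dE]] := dP; case: n => [|n] in Pl m okP dP eP L0 dg dgP dE *.
  (* A divisor without places is zero, so [L0] already concerns the everywhere regular functions. *)
  exists 0%N; apply: dim_le_mul (oner_neq0 E) _ L0 => x rx; rewrite mulr1.
  by apply/in_LRRP; split=> [[]|v pv _] //; apply: rx.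
have [pP _] := okP.
have L1 := dim_le_add_place pP (dgP ord0) L0.
have [l1 _ e1] := dim_le_ell L1.
have deg1 : divisor_degree iota Pl (fun i => m i + (i == ord0)%:Z) (d + (dg ord0)%:Z).
  exists dg; split=> //; under [RHS]eq_bigr do rewrite mulrDl.
  rewrite big_split /= -dE; congr (_ + _); rewrite (bigD1 ord0) //= mul1r big1 ?addr0 //.
  by move=> i /negbTE->; rewrite mul0r.
(* By [dl] the degree [d] is 0, so the enlarged divisor has positive degree and a nonzero space. *)
apply: (dim_le_embed _ _ _ _ okP e1); have := genus1_degree_le okP deg1 (ell_dim_le e1).
by have := place_degree_gt0 (pP ord0) (dgP ord0); lia.
Qed.

Lemma zeros_le_poles a n (Z : 'I_a -> E -> int) (Pl : 'I_n -> E -> int)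
    (B : 'I_n -> nat) f :
  (forall j, rational_place iota (Z j)) ->
  (forall i j, i != j -> ~ same_place allE (Z i) (Z j)) ->
  (forall i, rational_place iota (Pl i)) ->
  f != 0 -> (forall j, val_ge (Z j) 1 f) ->
  in_LRR iota Pl (fun i => (B i)%:Z) f -> (a <= \sum_i B i)%N.
Proof.
move=> rZ dZ rP f0 zf /in_LRRP[gf rf]; have [k bk] := finite_dim_regular.
have pP i := rational_is_place (rP i); have pZ i := rational_is_place (rZ i).
(* The final inequality is [M a <= k + M b], with [b] the sum of the [B i]; any [M > k] then forces
   [a <= b]. *)
pose M := k.+1.
have fM0 : f ^+ M != 0 by rewrite expf_neq0.
have bB := dim_le_effective (B := fun i => (M * B i)%N) rP bk.
have bZ : dim_le (in_LRR iota Z (fun=> M%:Z)) (k + \sum_i M * B i).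
  apply: (dim_le_mul fM0 _ bB) => x /in_LRRP[gx rx].
  have in_Z v : is_place iota v -> ~ (forall i, ~ same_place allE v (Z i)) ->
      val_ge v 0 (x * f ^+ M).
    move=> pv /not_all_ex_not[j /NNPP vj].
    have [->|x0] := eqVneq x 0; first by left; rewrite mul0r.
    have xf0 : x * f ^+ M != 0 by apply: mulf_neq0 x0 fM0.
    right; rewrite (vj _ I xf0); apply: (val_ge_neq0 xf0).
    have -> : 0 = - M%:Z + 1 *+ M by rewrite natz addNr.
    apply: (val_geM (pZ j)); first exact: gx.
    exact: (val_geX (pZ j) M (zf j)).
  have out_Z v e : is_place iota v -> (forall i, ~ same_place allE v (Z i)) ->
      val_ge v e f -> val_ge v (e *+ M) (x * f ^+ M).
    move=> pv nv vf; rewrite -[e *+ M]add0r; apply: (val_geM pv); first exact: rx.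
    exact: (val_geX pv M vf).
  apply/in_LRRP; split=> [i|v pv nv].
    (* The families [Pl] and [Z] are not assumed disjoint; at a place of [Z] the zero of [f ^+ M]
       cancels the pole of [x]. *)
    have [nZ|inZ] := classic (forall j, ~ same_place allE (Pl i) (Z j)).
      have -> : - (M * B i)%:Z = - (B i)%:Z *+ M by rewrite -mulr_natr natz; lia.
      by apply: out_Z.
    by apply: val_geW (in_Z _ (pP i) inZ); lia.
  have [nZ|inZ] := classic (forall j, ~ same_place allE v (Z j)).
    by rewrite -[0](mul0rn _ M); apply: out_Z => //; apply: rf.
  exact: in_Z.
have okZ : divisor_ok iota Z by split.
have degZ : divisor_degree iota Z (fun=> M%:Z) (a * M)%N%:Z.
  exists (fun=> 1%N); split=> [i|]; first by case: (rZ i).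
  by rewrite mulr1 sumr_const card_ord -mulr_natl natz PoszM.
have := genus1_degree_le okZ degZ bZ; rewrite -big_distrr /= lez_nat /M; nia.
Qed.
End ZerosAndPoles.

(** * Block codes *)

Section CodingTheory.
Variable K : finFieldType.

(** The minors are indexed by increasing row selections, so a set of rows has to be listed in
    increasing order. *)
Lemma increasing_into_set n m (A : {set 'I_n}) : (m <= #|A|)%N ->
  exists f : 'I_m -> 'I_n,
    (forall a b : 'I_m, (a < b)%N -> (f a < f b)%N) /\ forall a, f a \in A.
Proof.
move=> mA; exists (fun i => enum_val (widen_ord mA i)); split=> [a b ab|a]; last exact: enum_valP.
pose lt_val := relpre (@nat_of_ord n) ltn.
have lt_tr : transitive lt_val by move=> x y w; apply: ltn_trans.
have srt : sorted lt_val (enum A).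
  have : sorted lt_val (enum 'I_n) by rewrite -sorted_map val_enum_ord iota_ltn_sorted.
  by rewrite enumT; apply: sorted_filter.
have enumE x0 (c : 'I_m) : enum_val (widen_ord mA c) = nth x0 (enum A) c.
  by rewrite /enum_val; apply: set_nth_default; rewrite -cardE (leq_trans (ltn_ord c)).
have ltA (c : 'I_m) : val c \in [pred k | k < size (enum A)]%N.
  by rewrite inE -cardE (leq_trans (ltn_ord c)).
have x0 := enum_val (widen_ord mA a).
by rewrite 2!(enumE x0); apply: (sorted_ltn_nth lt_tr x0 srt _ _ (ltA a) (ltA b) ab).
Qed.

Definition maximal_minors_unit m r (M : 'M[K]_(m, r)) := forall f : 'I_r -> 'I_m,
  (forall a b : 'I_r, (a < b)%N -> (f a < f b)%N) -> rowsub f M \in unitmx.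

Lemma mds_many_zeros m r (M : 'M[K]_(m, r)) (A : 'cV_r) : maximal_minors_unit M ->
  (r <= #|[set v | (M *m A) v 0%R == 0%R]|)%N -> A = 0.
Proof.
move=> uM /increasing_into_set[f [fI fZ]].
have : rowsub f M *m A = 0.
  apply/matrixP => i j; rewrite mul_rowsub_mx !mxE ord1.
  by have := fZ i; rewrite inE !mxE => /eqP.
by move=> /(congr1 (mulmx (invmx (rowsub f M)))); rewrite mulKmx ?uM // mulmx0.
Qed.

Definition block_form m r (M : 'M[K]_(m, r.+1)) (A : 'cV[K]_r.+1) (w : option 'I_m) : K :=
  if w is Some v then (M *m A) v 0 else A 0 0.

Lemma sum_option (I : finType) (F : option I -> nat) :
  (\sum_w F w = F None + \sum_i F (Some i))%N.
Proof.
rewrite (bigD1 None) //=; congr addn.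
rewrite (reindex_omap Some id) /=; last by case.
by apply: eq_bigl => i; rewrite eqxx.
Qed.

Lemma count_neq0 (I : finType) (F : I -> K) :
  (\sum_i (F i != 0%R) + #|[set i | F i == 0%R]| = #|I|)%N.
Proof.
rewrite -[RHS]sum1_card -sum1dep_card [X in (_ + X)%N]big_mkcond -big_split /=.
by apply: eq_bigr => i _; case: eqP.
Qed.

(* The block code has parameters [[r + 2, r, 3]] with [r] replaced by [r.+1]:
   the rows of [M] together with the first unit vector. *)
Lemma block_weight r (M : 'M[K]_(r.+2, r.+1)) (A : 'cV[K]_r.+1) :
  maximal_minors_unit M -> maximal_minors_unit (col' ord0 M) -> A != 0 ->
  (3 <= \sum_w (block_form M A w != 0%R))%N.
Proof.
move=> uM uM' A0; rewrite sum_option /=.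
pose z v : K := (M *m A) v 0; pose Z := [set v | z v == 0%R].
have : (\sum_v (z v != 0%R) + #|Z| = r.+2)%N by rewrite count_neq0 card_ord.
rewrite -[X in (_ <= _ + X)%N]/(\sum_v (z v != 0%R))%N.
have : (#|Z| < r.+1)%N by rewrite ltnNge; apply: contra A0 => /(mds_many_zeros uM)->.
have [A00|_] := eqVneq (A 0 0) 0; last by rewrite /= add1n; lia.
(* With the additional coordinate zero, three nonzero entries of [M *m A] are needed: the first
   column no longer contributes, and the minors of the remaining ones bound the zeros. *)
suff : (#|Z| < r)%N by rewrite /=; lia.
rewrite ltnNge; apply: contra A0 => Zr.
have MA : M *m A = col' ord0 M *m row' ord0 A.
  apply/matrixP => i j; rewrite !mxE big_ord_recl ord1 A00 mulr0 add0r.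
  by apply: eq_bigr => k _; rewrite !mxE.
rewrite /Z /z MA in Zr; have /matrixP A'0 := mds_many_zeros uM' Zr.
apply/eqP/matrixP => i j; rewrite ord1 mxE.
by case: (unliftP ord0 i) => [k ->|-> //]; have := A'0 k 0; rewrite !mxE.
Qed.

(** A polynomial of degree below [t] with [s >= t] distinct roots is zero. *)
Lemma eval_coefs_eq0 t s (a : 'I_t -> K) (zeta : 'I_s -> K) :
  injective zeta -> (t <= s)%N ->
  (forall u, \sum_(j < t) a j * zeta u ^+ j = 0) -> forall j, a j = 0.
Proof.
move=> zI ts a0 j.
pose E i := if insub i is Some j' then a j' else 0.
have EP (j' : 'I_t) : E j' = a j' by rewrite /E valK.
pose p := \poly_(i < t) E i.
suff p0 : p = 0 by rewrite -EP; have := coef_poly t E j; rewrite ltn_ord -/p p0 coef0.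
apply/eqP; apply: contraT => p0.
have := max_poly_roots p0 (rs := [seq zeta u | u <- enum 'I_s]).
rewrite map_inj_uniq ?enum_uniq // size_map -cardE card_ord.
have rts : all (root p) [seq zeta u | u <- enum 'I_s].
  apply/allP => _ /mapP[u _ ->]; apply/eqP; rewrite horner_poly -[RHS](a0 u).
  by apply: eq_bigr => i _; rewrite EP.
by move=> /(_ rts isT)/leq_trans/(_ (size_poly t E)); rewrite ltnNge ts.
Qed.

Lemma linear_code_sub n (C : {set 'rV[K]_n}) x y :
  linear_code C -> x \in C -> y \in C -> x - y \in C.
Proof. by move=> [_ lC] xC yC; rewrite addrC -scaleN1r; apply: lC. Qed.

(** A linear code equals its span, so counting words gives the dimension without exhibiting a
    basis. *)
Lemma linear_code_dim n (C : {set 'rV[K]_n}) k :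
  linear_code C -> #|C| = (#|K| ^ k)%N -> code_dim C = k.
Proof.
move=> [C0 lC] cC; apply: (@expnI #|K|); first exact: finNzRing_gt1.
rewrite -cC /code_dim -card_vspace; apply: eq_card => x.
apply/idP/idP => [|xC]; last by apply: memv_span; rewrite mem_enum.
move=> /(@coord_span _ _ _ (in_tuple (enum C)))->.
elim/big_ind: _ => // [y y' yC y'C|i _]; first by rewrite -[y]scale1r; apply: lC.
rewrite -[_ *: _]addr0; apply: lC => //.
by rewrite -mem_enum mem_nth.
Qed.

Definition weight n (x : 'rV[K]_n) : nat := (\sum_j (x 0%R j != 0%R))%N.

Lemma hamming_weight n (x y : 'rV[K]_n) : hamming x y = weight (x - y).
Proof.
rewrite /hamming /weight -sum1dep_card big_mkcond /=.
by apply: eq_bigr => j _; rewrite !mxE subr_eq0; case: eqP.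
Qed.

End CodingTheory.

(** * Coordinates grouped into blocks *)

Section BlockStructure.
Variables (s r : nat).

(* In the block of [u], [Some v] stands for the place [P_{u,v}] and [None] for the
   additional coordinate [z(Q_u)]; [r.+1] is the locality parameter. *)
Lemma block_coord_subproof (uw : 'I_s * option 'I_r.+2) :
  ((if uw.2 is Some v then uw.1 * r.+2 + v else s * r.+2 + uw.1) < s * (r.+1 + 2))%N.
Proof.
case: uw => u [v|] /=; have := ltn_ord u; last by nia.
by have := ltn_ord v; nia.
Qed.

Definition block_coord uw : 'I_(s * (r.+1 + 2)) := Ordinal (block_coord_subproof uw).

Lemma block_coord_bij : bijective block_coord.
Proof.
apply: inj_card_bij; last by rewrite card_prod card_option !card_ord addn2.
move=> [u [v|]] [u' [v'|]] /(congr1 val) /= e; have lu := ltn_ord u; have lu' := ltn_ord u'.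
- have lv := ltn_ord v; have lv' := ltn_ord v'.
  have := congr1 (divn^~ r.+2) e; rewrite !divnMDl // !divn_small // !addn0 => uu.
  move: e; rewrite uu => /addnI vv.
  by congr (_, Some _); apply: val_inj.
- by have := ltn_ord v; have := leq_mul lu (leqnn r.+2); lia.
- by have := ltn_ord v'; have := leq_mul lu' (leqnn r.+2); lia.
- by move/addnI: e => uu; congr (_, None); apply: val_inj.
Qed.

Lemma sum_block_coord (F : 'I_(s * (r.+1 + 2)) -> nat) :
  (\sum_j F j = \sum_u \sum_w F (block_coord (u, w)))%N.
Proof.
rewrite pair_bigA /= (reindex block_coord); last exact: onW_bij block_coord_bij.
by apply: eq_bigr => -[u w].
Qed.

End BlockStructure.

(** * Parameters of a code given block by block *)

Section EvaluationCode.
Variables (K : finFieldType) (s r t : nat).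
Variables (M : 'I_s -> 'M[K]_(r.+2, r.+1)) (zeta : 'I_s -> K).
Hypotheses (uM : forall u, maximal_minors_unit (M u))
  (uM' : forall u, maximal_minors_unit (col' ord0 (M u)))
  (zetaI : injective zeta) (ts : (t <= s)%N).

Let coefs : finType := ({ffun 'I_t -> K} * {ffun 'I_r * 'I_t.-1 -> K})%type.

Definition block_coefs (p : coefs) u : 'cV[K]_r.+1 :=
  \col_i if unlift ord0 i is Some j then \sum_(k < t.-1) p.2 (j, k) * zeta u ^+ k
         else \sum_(k < t) p.1 k * zeta u ^+ k.

Variable cw : coefs -> 'rV[K]_(s * (r.+1 + 2)).
Hypothesis cwE : forall p u w,
  cw p 0 (block_coord (u, w)) = block_form (M u) (block_coefs p u) w.

Let C := [set cw p | p : coefs].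

Lemma block_formP m n (N : 'M[K]_(m, n.+1)) a A B w :
  block_form N (a *: A + B) w = a * block_form N A w + block_form N B w.
Proof. by case: w => [v|] /=; rewrite ?mulmxDr -?scalemxAr !mxE. Qed.

(** The coefficients of the combination are recorded because [cw_inj] recovers [p = q] from those of
    the difference. *)
Lemma cw_linear a p q : exists p', a *: cw p + cw q = cw p' /\
  (forall k, p'.1 k = a * p.1 k + q.1 k) /\ (forall jk, p'.2 jk = a * p.2 jk + q.2 jk).
Proof.
exists ([ffun k => a * p.1 k + q.1 k], [ffun jk => a * p.2 jk + q.2 jk]).
split; last by split=> k; rewrite ffunE.
apply/rowP => j; have [g _ bK] := block_coord_bij s r.
rewrite -(bK j); case: (g j) => u w; rewrite !mxE !cwE -block_formP; congr block_form.
apply/colP => i; rewrite !mxE; case: (unlift ord0 i) => [k|] /=.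
all: rewrite mulr_sumr -big_split; apply: eq_bigr => l _; rewrite ffunE /=; ring.
Qed.

Lemma cw_block_eq0 p : (forall j, cw p 0 j = 0) -> forall u, block_coefs p u = 0.
Proof.
move=> p0 u; apply/eqP; apply: contraT => /(block_weight (uM u) (uM' u)).
by rewrite big1 // => w _; rewrite -cwE p0 eqxx.
Qed.

Lemma cw_eq0 p : cw p = 0 -> (forall k, p.1 k = 0) /\ (forall jk, p.2 jk = 0).
Proof.
move=> p0; have /(_ _)/colP A0 : forall u, block_coefs p u = 0.
  by apply: cw_block_eq0 => j; rewrite p0 mxE.
split=> [k|[j k]].
  apply: (eval_coefs_eq0 (a := p.1) zetaI ts) => u.
  by have := A0 u ord0; rewrite !mxE unlift_none.
apply: (eval_coefs_eq0 (a := fun k => p.2 (j, k)) zetaI (leq_trans (leq_pred t) ts)) => u.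
by have := A0 u (lift ord0 j); rewrite !mxE liftK.
Qed.

Lemma cw_inj : injective cw.
Proof.
move=> p q pq; have [p' [e [e1 e2]]] := cw_linear (-1) p q.
have [] := @cw_eq0 p'; first by rewrite -e pq scaleN1r addNr.
move=> z1 z2; case: p q {pq e} e1 e2 => p1 p2 [q1 q2] /= e1 e2; congr (_, _); apply/ffunP.
  by move=> k; have := e1 k; rewrite z1 mulN1r addrC => /esym/subr0_eq.
by move=> k; have := e2 k; rewrite z2 mulN1r addrC => /esym/subr0_eq.
Qed.

Lemma linear_cw : linear_code C.
Proof.
split=> [|a x y /imsetP[p _ ->] /imsetP[q _ ->]]; last first.
  by have [p' [-> _]] := cw_linear a p q; apply: imset_f.
pose p0 : coefs := ([ffun=> 0], [ffun=> 0]).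
have [p' [e _]] := cw_linear (-1) p0 p0.
by have := imset_f cw (in_setT p'); rewrite -e scaleN1r addNr => /imsetP[q _ ->]; apply: imset_f.
Qed.

Lemma dim_cw : (0 < t)%N -> code_dim C = (r.+1 * t - r.+1 + 1)%N.
Proof.
move=> t0; apply: linear_code_dim linear_cw _.
rewrite card_imset; last exact: cw_inj.
(* There are [t + r * t.-1] free coefficients; [0 < t] makes this agree with the truncated
   subtraction. *)
rewrite card_prod !card_ffun card_prod !card_ord -expnD; congr (_ ^ _)%N; nia.
Qed.

(** The recovery set of a coordinate is its whole block, of size [r.+3]; a difference of words that
    is nonzero there has nonzero [block_coefs], hence weight at least 3 on it. *)
Lemma LRC_cw : is_LRC C r.+1 3.
Proof.
move=> i; have [g _ bK] := block_coord_bij s r; case gi: (g i) => [u w].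
exists [set block_coord (u, w) | w : option 'I_r.+2]; split.
- by rewrite -[i]bK gi; apply: imset_f.
- by apply: leq_trans (leq_imset_card _ _) _; rewrite card_option card_ord addn3 subn1.
move=> x y xC yC /existsP[j /andP[/imsetP[w' _ ->]]].
have := linear_code_sub linear_cw xC yC; set xy := x - y => /imsetP[p _ xyE].
have diffE k : (x ord0 k != y ord0 k) = (cw p 0 k != 0) by rewrite -xyE !mxE subr_eq0.
rewrite diffE cwE => nz.
have A0 : block_coefs p u != 0.
  by apply: contraNneq nz => ->; case: (w') => [v|] /=; rewrite ?mulmx0 mxE.
apply: leq_trans (block_weight (uM u) (uM' u) A0) _.
under eq_bigr do rewrite -cwE.
rewrite -sum1dep_card (big_mkcond (fun k => _ && _)).
rewrite (bigID (mem [set block_coord (u, w) | w : option 'I_r.+2])) /=.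
rewrite big_imset /=; last by move=> w1 w2 _ _ /(bij_inj (block_coord_bij s r))[].
apply: leq_trans (leq_addr _ _); apply: leq_sum => w1 _.
rewrite diffE; have -> : block_coord (u, w1) \in [set block_coord (u, w) | w : option 'I_r.+2].
  by apply/imsetP; exists w1.
by case: eqP.
Qed.

Lemma weight_cw p : weight (cw p) = (\sum_u \sum_w (block_form (M u) (block_coefs p u) w != 0%R))%N.
Proof. by rewrite /weight sum_block_coord; under eq_bigr do under eq_bigr do rewrite cwE. Qed.

(* The word given by [\prod_(u != u0) ('X - zeta u)] is supported on the block [u0]. *)
Lemma low_weight_cw : t = s -> (0 < s)%N ->
  exists p, cw p != 0 /\ (weight (cw p) <= r.+3)%N.
Proof.
move=> ets s0; pose u0 := Ordinal s0.
pose rs := [seq zeta u | u <- enum (predC1 u0)].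
pose f := \prod_(x <- rs) ('X - x%:P).
(* With [s - 1] linear factors the size is [s], which fits because [t = s]. *)
have sf : (size f <= t)%N by rewrite size_prod_XsubC size_map -cardE cardC1 card_ord prednK // ets.
pose p : coefs := ([ffun k : 'I_t => f`_k], [ffun=> 0]).
have f0 u : (f.[zeta u] == 0) = (u != u0).
  by rewrite -/(root f _) root_prod_XsubC mem_map // mem_enum !inE.
have pE u i : block_coefs p u i 0 = if i == ord0 then f.[zeta u] else 0.
  rewrite mxE; case: unliftP => [j ->|->] /=.
    by rewrite big1 // => k _; rewrite ffunE mul0r.
  by rewrite (horner_coef_wide _ sf); apply: eq_bigr => k _; rewrite ffunE.
exists p; split.
  apply: contraFneq (f0 u0) => p0; have := pE u0 ord0; rewrite eqxx => <-.
  by have := cwE p u0 None; rewrite p0 mxE /= => <-; rewrite eqxx.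
rewrite weight_cw (bigD1 u0) //= [X in (_ + X)%N]big1 ?addn0 => [|u uu0].
  apply: (@leq_trans (\sum_(w : option 'I_r.+2) 1)).
    by apply: leq_sum => w _; case: (_ != _).
  by rewrite sum1_card card_option card_ord.
have /eqP fu0 : f.[zeta u] == 0 by rewrite f0.
have -> : block_coefs p u = 0.
  by apply/colP => i; rewrite pE mxE fu0; case: ifP.
by rewrite big1 // => -[v|] _ /=; rewrite ?mulmx0 mxE eqxx.
Qed.

(** The lower bound is a hypothesis here, since it comes from counting zeros of [f_a] in [E] and not
    from the blocks. *)
Lemma min_dist_cw : t = s -> (0 < s)%N ->
  (forall p, cw p != 0 -> (r.+3 <= weight (cw p))%N) -> min_dist C r.+3.
Proof.
move=> ets s0 lb; split.
  have [p [p0 wp]] := low_weight_cw ets s0; exists (cw p), 0.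
  split; rewrite ?imset_f //; first by case: linear_cw.
  by rewrite hamming_weight subr0; apply/eqP; rewrite eqn_leq wp lb.
move=> x y xC yC; rewrite hamming_weight -subr_eq0.
by have /imsetP[p _ ->] := linear_code_sub linear_cw xC yC; apply: lb.
Qed.

End EvaluationCode.

(** * The code of the theorem *)

Section PolesOfPolynomials.
Variables (K : finFieldType) (E : fieldType) (iota : {rmorphism K -> E}).

Lemma val_ge_poly v (alpha n : nat) (a : 'I_n -> K) z : is_place iota v ->
  val_ge v (- alpha%:Z) z ->
  val_ge v (- (alpha * n.-1)%N%:Z) (\sum_(j < n) iota (a j) * z ^+ j).
Proof.
move=> pv vz; apply: (val_ge_sum pv) => j; apply: (val_geZ pv).
apply: val_geW (val_geX pv j vz); rewrite -mulr_natr natz.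
have : (j <= n.-1)%N by have := ltn_ord j; lia.
by move=> jn; rewrite mulNr lerN2 -PoszM lez_nat leq_mul2l jn orbT.
Qed.

(** Evaluation of [z] only inspects values at [z - c], so a place of [F] and an unramified place
    above it give the same result. *)
Lemma evalp_restrict (S : E -> Prop) (v w : E -> int) z :
  (forall c, S (z - iota c)) -> (forall x, S x -> x != 0 -> v x = w x) ->
  evalp iota w z = evalp iota v z.
Proof.
move=> Sz vw; rewrite /evalp; congr odflt; apply: eq_pick => c /=.
by case: eqP => //= /eqP zc0; rewrite (vw _ (Sz c)).
Qed.

Lemma pole_divisor_regular m x (Pl : 'I_m -> E -> int) (A : pred 'I_m) v :
  pole_divisor_is iota x Pl A -> is_place iota v ->
  (forall i, A i -> ~ same_place allE v (Pl i)) -> val_ge v 0 x.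
Proof. by move=> [_ _ rx] pv nv; right; apply: rx. Qed.

Lemma pole_divisor_val m x (Pl : 'I_m -> E -> int) (A : pred 'I_m) i :
  pole_divisor_is iota x Pl A -> A i -> val_ge (Pl i) (-1) x.
Proof. by move=> [_ Ax _] Ai; right; rewrite Ax. Qed.

End PolesOfPolynomials.

Theorem mainTheorem9
  (K : finFieldType) (E : fieldType) (iota : {rmorphism K -> E})
  (N r s t : nat)
  (G : 'I_r.+1 -> E -> E)
  (Q : 'I_s.+1 -> E -> int) (P : 'I_s.+1 -> 'I_r.+1 -> E -> int)
  (z : E) (omega : nat -> E) :
  (* E/F_q elliptic function field, full constant field F_q, N rational places *)
  elliptic_function_field iota ->
  num_rational_places iota N ->
  (* parameters *)
  (2 <= r)%N -> (2 <= s)%N -> (s <= (N - (2 * r + 4)) %/ (r + 1))%N ->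
  (1 <= t)%N -> (t <= s)%N ->
  (* G is a subgroup of Aut(E/F_q) of order r+1, F = E^G = F_q(z) *)
  aut_subgroup iota G ->
  fixed_field G z ->
  (forall y, fixed_field G y -> in_Kx iota z y) ->
  (* Q_0..Q_s distinct rational places of F *)
  (forall u, rational_place_of iota (fixed_field G) (Q u)) ->
  (forall u u', u != u' -> ~ same_place (fixed_field G) (Q u) (Q u')) ->
  (* they split completely in E/F: P_{u,1..r+1} are exactly the places of E
     over Q_u, pairwise distinct, unramified (e = 1) and rational (f = 1) *)
  (forall u v, rational_place iota (P u v)) ->
  (forall u v v', v != v' -> ~ same_place allE (P u v) (P u v')) ->
  (forall u v x, fixed_field G x -> x != 0 -> P u v x = Q u x) ->
  (forall u R, is_place iota R -> lies_over (fixed_field G) R (Q u) ->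
     exists v, same_place allE R (P u v)) ->
  (* (z)_oo = P_{0,1} + ... + P_{0,r+1} *)
  pole_divisor_is iota z (P ord0) predT ->
  (* omega_0 = 1, (omega_i)_oo = P_{0,1} + ... + P_{0,i+1} for 1 <= i <= r-1 *)
  omega 0%N = 1 ->
  (forall i, (1 <= i <= r.-1)%N ->
     pole_divisor_is iota (omega i) (P ord0) (fun v : 'I_r.+1 => (v <= i)%N)) ->
  (* omega_1, ..., omega_{r-1} linearly independent over F *)
  (forall g : 'I_r.-1 -> E, (forall i, fixed_field G (g i)) ->
     \sum_i g i * omega i.+1 = 0 -> forall i, g i = 0) ->
  (* every r x r submatrix of M_u is invertible (1 <= u <= s) *)
  (forall u : 'I_s.+1, u != ord0 -> forall f : 'I_r -> 'I_r.+1,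
     (forall a b : 'I_r, (a < b)%N -> (f a < f b)%N) ->
     rowsub f (Mmat iota P omega u) \in unitmx) ->
  (* every (r-1) x (r-1) submatrix of M'_u is invertible (1 <= u <= s) *)
  (forall u : 'I_s.+1, u != ord0 -> forall f : 'I_r.-1 -> 'I_r.+1,
     (forall a b : 'I_r.-1, (a < b)%N -> (f a < f b)%N) ->
     rowsub f (Mmat' iota P omega u) \in unitmx) ->
  let C := code_CE iota t P Q z omega in
  [/\ linear_code C,
      is_LRC C r 3,
      code_dim C = (r * t - r + 1)%N &
      t = s ->
        optimal_LRC C r 3 /\ min_dist C (s * (r + 2) - (t - 1) * (r + 2))%N].
Proof.
(* From here on the locality parameter is [r.+1], and each block has [r.+2] places. *)
move=> [_ _ genus1] _; case: r G P => [|r] // G P r2 s2 _ t1 ts.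
move=> aG Gz FKz rQ dQ rP dP PQ _ zpole om0 ompole _ uM uM'.
have pP u v := rational_is_place (rP u v).
have ozK c : fixed_field G (z - iota c).
  move=> i; have [aut _ _] := aG; have [gD gM g1 _ gc] := aut i.
  by rewrite -rmorphN gD gc (Gz i).
have zc0 c : z - iota c != 0.
  have [z0 /(_ ord0 isT) Pz _] := zpole; rewrite subr_eq0; apply: contraNneq z0 => zc.
  rewrite zc fmorph_eq0; have [//|c0] := eqVneq c 0.
  by rewrite zc (place_iota (pP _ _) c0) in Pz.
have PP u u' v v' : same_place allE (P u v) (P u' v') -> (u, v) = (u', v').
  move=> same; have uu : u = u'.
    apply/eqP; apply: contraT => /dQ[] x Fx x0.
    by rewrite -(PQ u v) // -(PQ u' v') // same.
  subst u'; congr (_, _); apply/eqP; apply: contraT => vv; case: (dP u v v' vv same).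
have P0P u v v' : u != ord0 -> ~ same_place allE (P u v) (P ord0 v').
  by move=> u0 /PP[e]; rewrite e eqxx in u0.
pose U (u : 'I_s) := lift ord0 u.
have U0 u : U u != ord0 by rewrite eq_sym neq_lift.
pose zeta u := evalp iota (Q (U u)) z.
have zres u v : residue_is iota (P (U u) v) z (zeta u).
  rewrite /zeta (evalp_restrict ozK (fun x => @PQ (U u) v x)) //.
  apply: evalp_residue => //; apply: pole_divisor_regular zpole _ _ => // i _.
  exact: P0P.
(* Since [F = K(z)], two places of [F] at which [z] has the same value coincide; they are compared
   through places of [E] above them. *)
have zetaI : injective zeta.
  move=> u u' zuu; apply: (@lift_inj _ ord0); apply/eqP; apply: contraT => uu.
  have normP w : exists y, [/\ fixed_field G y, y != 0 & P w ord0 y = 1].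
    have [[_ _ _ [y [Fy y0 Qy]]] _] := rQ w.
    by exists y; split=> //; rewrite PQ.
  case: (dQ _ _ uu) => x Fx x0; rewrite -(PQ _ ord0) // -(PQ (lift ord0 u') ord0) //.
  have zres' : residue_is iota (P (U u') ord0) z (zeta u) by rewrite zuu.
  exact: (same_place_residue (zc0 _) (pP _ _) (pP _ _) (zres u _) zres' FKz (normP _) (normP _)).
pose M u := Mmat iota P omega (U u).
have ompole' (i : 'I_r) : pole_divisor_is iota (omega i.+1) (P ord0) (fun v => (v <= i.+1)%N).
  by apply: ompole; rewrite /= ltn_ord.
have omres u v (i : 'I_r) : residue_is iota (P (U u) v) (omega i.+1) (M u v (lift ord0 i)).
  rewrite mxE; apply: evalp_residue => //.
  by apply: pole_divisor_regular (ompole' i) _ _ => // j _; apply: P0P.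
have M1 u v : M u v ord0 = 1.
  rewrite mxE om0; apply: (residue_evalp (pP _ _)); rewrite -(rmorph1 iota).
  exact: residue_is_iota.
pose F p := f_a iota (r := r.+1) (t := t) z omega p.1 p.2.
have fres p u v : residue_is iota (P (U u) v) (F p)
    (block_form (M u) (block_coefs zeta p u) (Some v)).
  rewrite /= mxE big_ord_recl M1 mul1r mxE unlift_none /=.
  apply: (residue_isD (pP _ _)); first apply: residue_is_sum => // j.
    apply: (residue_isM (pP _ _)); first exact: residue_is_iota.
    exact: residue_isX.
  apply: residue_is_sum => // i.
  rewrite [X in residue_is _ _ _ X]mulrC [block_coefs _ _ _ _ _]mxE liftK.
  apply: (residue_isM (pP _ _)) => //; apply: residue_is_sum => // j.
  by apply: (residue_isM (pP _ _)); [apply: residue_is_iota | apply: residue_isX].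
pose cw (p : {ffun 'I_t -> K} * {ffun 'I_r * 'I_t.-1 -> K}) : 'rV[K]_(s * (r.+1 + 2)) :=
  \row_k codeword_coord iota P Q z omega p.1 p.2 k.
have inordU (u : 'I_s) : inord u.+1 = U u by apply: val_inj; rewrite /= inordK // ltnS ltn_ord.
have cwE p u w : cw p 0 (block_coord (u, w)) = block_form (M u) (block_coefs zeta p u) w.
  rewrite mxE /codeword_coord; case: w => [v|] /=; last first.
    by rewrite ltnNge leq_addr /= addKn inordU mxE unlift_none.
  have -> : (u * r.+2 + v < s * r.+2)%N.
    by have := ltn_ord v; have := leq_mul (ltn_ord u) (leqnn r.+2); lia.
  rewrite divnMDl // divn_small // addn0 modnMDl modn_small // inordU inord_val.
  exact: residue_evalp (fres p u v).
have uMu u : maximal_minors_unit (M u) by move=> f fI; apply: uM (U0 u) f fI.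
have uMu' u : maximal_minors_unit (col' ord0 (M u)).
  move=> f fI; have := uM' _ (U0 u) f fI.
  by congr (_ \in unitmx); apply/matrixP => i j; rewrite !mxE.
have lin := linear_cw cwE; have lrc := LRC_cw uMu uMu' cwE.
have dimC := dim_cw uMu uMu' zetaI ts cwE t1.
split=> // ets.
have zpoles v : val_ge (P ord0 v) (- 1%:Z) z by apply: pole_divisor_val zpole _.
(* The last place over [Q_0] is a pole of no [omega i]; this saves the one zero needed below. *)
have ompoles v (i : 'I_r) : val_ge (P ord0 v) (- (v != ord_max)%:Z) (omega i.+1).
  have [vi|vi] := leqP v i.+1.
    have -> : (v != ord_max) by apply: contraTneq vi => ->; rewrite -ltnNge /= ltnS.
    exact: (pole_divisor_val (ompole' i) vi).
  apply: (@val_geW _ _ 0); first by rewrite oppr_le0.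
  apply: pole_divisor_regular (ompole' i) (pP _ _) _ => j ji /PP[vj].
  by rewrite vj ltnNge ji in vi.
have omega_part_ge (p : {ffun 'I_t -> K} * {ffun 'I_r * 'I_t.-1 -> K}) w (a b : nat) :
    is_place iota w -> val_ge w (- a%:Z) z ->
    (forall i : 'I_r, val_ge w (- b%:Z) (omega i.+1)) ->
    val_ge w (- (a * t.-2 + b)%N%:Z)
      (\sum_(i < r) (\sum_(j < t.-1) iota (p.2 (i, j)) * z ^+ j) * omega i.+1).
  move=> pw zw omw; apply: (val_ge_sum pw) => i; rewrite PoszD opprD.
  by apply: (val_geM pw (val_ge_poly (fun j => p.2 (i, j)) pw zw)).
have Freg p w : is_place iota w -> (forall i, ~ same_place allE w (P ord0 i)) ->
    val_ge w 0 (F p).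
  move=> pw nw; have zw : val_ge w (- 0%:Z) z.
    by rewrite oppr0; apply: pole_divisor_regular zpole pw _ => i _.
  apply: (val_geD pw); first by have := val_ge_poly (n := t) p.1 pw zw; rewrite mul0n oppr0.
  have := @omega_part_ge p w 0%N 0%N pw zw; rewrite mul0n oppr0; apply => i.
  by apply: pole_divisor_regular (ompole' i) pw _ => j _.
have s_t1 : (s * r.+2 = r.+2 * t.-1 + r.+2)%N.
  by rewrite addnC -mulnS prednK // mulnC ets.
have s_t2 : (s * r.+2 = r.+2 * t.-2 + r.+2 + r.+2)%N.
  by rewrite s_t1; congr (_ + _)%N; rewrite addnC -mulnS prednK // -ltnS prednK // ets.
have lb p : cw p != 0 -> (r.+3 <= weight (cw p))%N.
  move=> cp0; rewrite (weight_cw cwE).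
  under eq_bigr do rewrite sum_option.
  rewrite big_split /= pair_bigA /=.
  pose g (uv : 'I_s * 'I_r.+2) : K := block_form (M uv.1) (block_coefs zeta p uv.1) (Some uv.2).
  pose T := [set uv | g uv == 0].
  have : (\sum_uv (g uv != 0%R) + #|T| = s * r.+2)%N by rewrite count_neq0 card_prod !card_ord.
  rewrite -[X in (_ < _ + X)%N]/(\sum_uv (g uv != 0%R))%N.
  (* If [F p] vanished, so would all its residues, and the minors of [M u] would make every block
     zero. *)
  have F0 : F p != 0.
    apply: contraNneq cp0 => F0; apply/eqP/rowP => j; rewrite [RHS]mxE.
    have [h _ hK] := block_coord_bij s r; rewrite -(hK j); case: (h j) => u w; rewrite cwE.
    have -> : block_coefs zeta p u = 0.
      apply: (mds_many_zeros (uMu u)); rewrite (_ : [set v | _] = setT) ?cardsT ?card_ord //.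
      apply/setP => v; rewrite !inE; apply/eqP/(residue_is_inj (pP (U u) v) (fres p u v)).
      by rewrite F0 -(rmorph0 iota); apply: residue_is_iota.
    by case: w => [v|] /=; rewrite ?mulmx0 mxE.
  have zle (B : 'I_r.+2 -> nat) : (forall v, val_ge (P ord0 v) (- (B v)%:Z) (F p)) ->
      (#|T| <= \sum_v B v)%N.
    move=> FB; pose Z (j : 'I_#|T|) := P (U (enum_val j).1) (enum_val j).2.
    apply: (zeros_le_poles (Z := Z) genus1 _ _ (rP ord0) F0) => [j|i j ij||].
    - exact: rP.
    - move/PP; case=> /val_inj e1 e2; case/eqP: ij; apply: enum_val_inj.
      by move: e1 e2; case: (enum_val i) (enum_val j) => ? ? [? ?] /= -> ->.
    - move=> j; have := fres p (enum_val j).1 (enum_val j).2.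
      have /= := enum_valP j; rewrite inE => /eqP; rewrite /g /= => ->.
      by rewrite /residue_is rmorph0 subr0.
    - by apply/in_LRRP; split=> // w pw nw; apply: Freg.
  (* A nonzero additional coordinate contributes 1 to the weight, and at most [r.+2 * t.-1] zeros
     leave [r.+2] nonzero values at places. *)
  have [/existsP[u Au]|] := boolP [exists u, block_coefs zeta p u 0 0 != 0].
    have := zle (fun=> t.-1); rewrite sum_nat_const card_ord => /(_ _)/=.
    rewrite (bigD1 u) //= Au.
    have H v : val_ge (P ord0 v) (- t.-1%:Z) (F p).
      apply: (val_geD (pP _ _)).
        by have := val_ge_poly p.1 (pP _ _) (zpoles v); rewrite mul1n.
      apply: val_geW (omega_part_ge p _ 1%N (v != ord_max) (pP _ _) (zpoles v) (ompoles v)).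
      by rewrite mul1n; case: (v != _); lia.
    by move=> /(_ H); lia.
  rewrite negb_exists => /forallP A0.
  have p0 : forall j, p.1 j = 0.
    apply: (eval_coefs_eq0 zetaI ts) => u; have := A0 u.
    by rewrite negbK mxE unlift_none => /eqP.
  (* Only the terms with some [omega i] remain, so the poles number at most [r.+2 * t.-2 + r.+1],
     one less than before. *)
  have := zle (fun v => t.-2 + (v != ord_max))%N.
  have H v : val_ge (P ord0 v) (- (t.-2 + (v != ord_max))%N%:Z) (F p).
    rewrite /F /f_a big1 ?add0r => [|j _]; last by rewrite p0 rmorph0 mul0r.
    by have := omega_part_ge p _ 1%N (v != ord_max) (pP _ _) (zpoles v) (ompoles v); rewrite mul1n.
  move=> /(_ H); rewrite big_split /= sum_nat_const card_ord.
  rewrite (bigD1 (P := xpredT) (ord_max : 'I_r.+2)) //= eqxx add0n.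
  rewrite (eq_bigr (fun=> 1%N)) => [|v ->//]; rewrite sum1_card cardC1 card_ord.
  by lia.
have s0 : (0 < s)%N by apply: ltnW.
have md := min_dist_cw zetaI cwE ets s0 lb.
split; [split=> //|].
  suff -> : (s * (r.+1 + 2) - code_dim (code_CE iota t P Q z omega)
     - (ceil_div (code_dim (code_CE iota t P Q z omega)) r.+1 - 1) * (3 - 1) + 1 = r.+3)%N.
    exact: md.
  rewrite dimC ets /ceil_div; case: (s) s0 => // s' _.
  (* The rounding in [ceil_div] is exact: the quotient of [k] by [r.+1] rounds up to [t = s]. *)
  have -> : (r.+1 * s'.+1 - r.+1 + 1 + r.+1.-1 = s'.+1 * r.+1)%N.
    by rewrite mulnS addKn mulSn /=; lia.
  by rewrite mulnK // mulnS addKn; lia.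
suff -> : (s * (r.+1 + 2) - (t - 1) * (r.+1 + 2) = r.+3)%N by exact: md.
by rewrite ets -mulnBl subKn //; lia.
Qed.
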